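(* Let $Q=\sqrt2\log\big(1+\sqrt2\big)$. For each $n$, let $D_{a,b}$ with $a=a(n)$, $b=b(n)$, $2a+b=n$, be a balanced dumbbell graph on $n$ vertices whose sum-Balaban index is the smallest among all balanced dumbbell graphs on $n$ vertices. Then $$ a=\sqrt[4]{Q}\,\sqrt n+o(\sqrt n)\quad\text{and}\quad b=n-o(n)\qquad (n\to\infty). $$
   Context: For a simple connected graph $G$ with $n$ vertices and $m$ edges, the transmission of a vertex $u$ is $w(u)=\sum_{x\in V(G)}{\rm dist}_G(u,x)$, and the sum-Balaban index is ${\rm SJ}(G)=\frac{m}{m-n+2}\sum_{uv\in E(G)}\frac{1}{\sqrt{w(u)+w(v)}}$. For positive integers $a,b$, the balanced dumbbell graph $D_{a,b}$ is obtained from the disjoint union of two complete graphs $K_a$, $K'_a$ (each on $a$ vertices) and a path $P_b=(v_0,v_1,\dots,v_{b-1})$ on $b$ vertices by joining every vertex of $K_a$ to $v_0$ and every vertex of $K'_a$ to $v_{b-1}$; it has $2a+b$ vertices. $\log$ is the natural logarithm. *)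

(* Defs.v *)
From HB Require Import structures.
From mathcomp Require Import all_boot all_order all_algebra.
From mathcomp Require Import all_classical all_reals all_analysis.

Set Implicit Arguments.
Unset Strict Implicit.
Unset Printing Implicit Defensive.

Import Order.TTheory GRing.Theory Num.Theory.
Import numFieldNormedType.Exports.

Record sgraph := SGraph {
  vertex :> finType;
  adj : rel vertex;
  adj_sym : symmetric adj;
  adj_irr : irreflexive adj }.

Arguments adj {s} : rename.

Definition connected_graph (G : sgraph) : Prop :=
  forall x y : G, connect (@adj G) x y.

Definition edges (G : sgraph) : {set {set G}} :=
  [set [set p.1; p.2] | p : G * G & adj p.1 p.2].

Definition walk_of_length (G : sgraph) (k : nat) (x y : G) : bool :=
  [exists p : k.-tuple G, path adj x p && (last x p == y)].

(* The least length of a walk from x to y. A shortest walk has fewer than #|G|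
   edges, so the search is exhaustive; the value is the dummy #|G| when no walk
   exists, which does not occur in a connected graph. *)
Definition dist (G : sgraph) (x y : G) : nat :=
  find (fun k => walk_of_length k x y) (iota 0 #|G|).

Definition transmission (G : sgraph) (u : G) : nat := \sum_(x : G) dist u x.

(* An edge is a two-element set [set u; v], so that the inner sum over it is
   w(u) + w(v). *)
Definition sum_Balaban (R : realType) (G : sgraph) : R :=
  let m := #|edges G| in
  let n := #|G| in
  (m%:R / (m%:R - n%:R + 2) *
   \sum_(E in edges G) (Num.sqrt (\sum_(u in E) transmission u)%N%:R)^-1)%R.

(* The two left summands are the cliques K_a and K'_a, the right one is the
   path v_0, ..., v_(b-1). *)
Definition dumbbell_vertex (a b : nat) : finType := ('I_a + 'I_a + 'I_b)%type.

Definition dumbbell_adj (a b : nat) : rel (dumbbell_vertex a b) :=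
  fun x y =>
    match x, y with
    | inl (inl i), inl (inl j) => i != j
    | inl (inr i), inl (inr j) => i != j
    | inr i, inr j => (i.+1 == j :> nat) || (j.+1 == i :> nat)
    | inl (inl _), inr j | inr j, inl (inl _) => j == 0 :> nat
    | inl (inr _), inr j | inr j, inl (inr _) => j == b.-1 :> nat
    | inl (inl _), inl (inr _) | inl (inr _), inl (inl _) => false
    end.

Lemma dumbbell_adj_sym (a b : nat) : symmetric (@dumbbell_adj a b).
Proof.
by move=> [[i|i]|i] [[j|j]|j] //=; rewrite 1?eq_sym // orbC.
Qed.

Lemma dumbbell_adj_irr (a b : nat) : irreflexive (@dumbbell_adj a b).
Proof. by move=> [[i|i]|i] /=; rewrite ?eqxx // orbb gtn_eqF. Qed.

Definition dumbbell (a b : nat) : sgraph :=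
  SGraph (@dumbbell_adj_sym a b) (@dumbbell_adj_irr a b).

Lemma card_dumbbell (a b : nat) : #|dumbbell a b| = 2 * a + b.
Proof. by rewrite !card_sum !card_ord addnn mul2n. Qed.

Lemma dumbbell_connected (a b : nat) : 0 < b -> connected_graph (dumbbell a b).
Proof.
case: b => // b _; set G := dumbbell a b.+1.
have cS : connect_sym (@adj G) by apply: sym_connect_sym; exact: adj_sym.
have P (k : nat) (kb : k < b.+1) :
    connect (@adj G) (inr ord0) (inr (Ordinal kb)).
  elim: k kb => [|k IH] kb; first by rewrite (_ : Ordinal kb = ord0) //; exact: val_inj.
  by apply: connect_trans (IH (ltnW kb)) (connect1 _); rewrite /= eqxx.
have C (x : G) : connect (@adj G) (inr ord0) x.
  case: x => [[i|i]|[k kb]]; last exact: P.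
  - exact: connect1.
  - by apply: connect_trans (P b (ltnSn b)) (connect1 _); rewrite /= eqxx.
by move=> x y; apply: connect_trans (C y); rewrite cS.
Qed.

Definition minimal_dumbbell (R : realType) (n a b : nat) : Prop :=
  [/\ 0 < a, 0 < b, 2 * a + b = n &
    forall a' b' : nat, 0 < a' -> 0 < b' -> 2 * a' + b' = n ->
      (sum_Balaban R (dumbbell a b) <= sum_Balaban R (dumbbell a' b'))%R].

(* Main.v *)
(* Summing over the three kinds of edges of D_(a,b)
   gives SJ = (1 + (n-2)/(a^2-a+1)) (clique part + path part), where the path
   edges contribute the terms 1/sqrt(2a(b+1) + j^2 + (b-j)^2) with 0 < j < b.
   For a = x sqrt n the clique part is about x^2 and the path part is about
   the integral of 1/sqrt(u^2+(1-u)^2) over [0,1], which is Q, so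
   SJ ~ (1 + 1/x^2)(x^2 + Q), minimal exactly at x^2 = sqrt Q with value
   (1 + sqrt Q)^2.  Bounding SJ from above at a = floor(Q^(1/4) sqrt n) and from
   below at an arbitrary a yields (a^2/n - sqrt Q)^2 <= o(1) for a minimizer. *)
Require Import Defs.
From mathcomp Require Import all_boot all_order all_algebra.
From mathcomp Require Import all_classical all_reals all_analysis.
From mathcomp Require Import zify ring lra.
Import Order.TTheory GRing.Theory Num.Theory.
Import numFieldNormedType.Exports.
Local Open Scope classical_set_scope.
Local Open Scope ring_scope.

Set Implicit Arguments.
Unset Strict Implicit.
Unset Printing Implicit Defensive.

(** * Transmissions in the dumbbell *)

(** Appending one step at the end of a walk raises [d x] by at most one, so the induction peels off
    the last vertex. *)
Lemma walk_of_length_lower (G : sgraph) (d : G -> G -> nat) :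
  (forall x, d x x = 0%N) ->
  (forall x y z, adj y z -> (d x z <= (d x y).+1)%N) ->
  forall k x y, walk_of_length k x y -> (d x y <= k)%N.
Proof.
move=> d0 dS k x y /existsP[p /andP[+ /eqP <-]].
rewrite -[X in (_ <= X)%N](size_tuple p); case: p => /= s _.
elim/last_ind: s => [|s z IH]; first by rewrite /= d0.
rewrite rcons_path last_rcons size_rcons => /andP[/IH ps sz].
exact: leq_trans (dS _ _ _ sz) _.
Qed.

Lemma walk_of_length_exists (G : sgraph) (d : G -> G -> nat) :
  (forall x y, d x y = 0%N -> x = y) ->
  (forall x y k, d x y = k.+1 -> exists2 z, adj x z & d z y = k) ->
  forall x y, walk_of_length (d x y) x y.
Proof.
move=> d0 dS x y; move: {-1}(d x y) (erefl (d x y)) => k.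
elim: k x => [|k IH] x dxy; apply/existsP.
  by exists [tuple]; rewrite /= (d0 _ _ dxy).
have [z xz /IH /existsP[p /andP[zp ly]]] := dS _ _ _ dxy.
by exists [tuple of z :: p]; rewrite /= xz zp.
Qed.

(** Growth by at most one per step makes [d] a lower bound on walk lengths; a neighbour that
    decreases it always exists, so greedy descent attains the bound. The bound by [#|G|] keeps the
    value inside the range searched by [find]. *)
Lemma dist_unique (G : sgraph) (d : G -> G -> nat) :
  (forall x y, (d x y == 0%N) = (x == y)) ->
  (forall x y z, adj y z -> (d x z <= (d x y).+1)%N) ->
  (forall x y k, d x y = k.+1 -> exists2 z, adj x z & d z y = k) ->
  (forall x y, (d x y < #|G|)%N) ->
  forall x y, dist x y = d x y.
Proof.
move=> d0 dL dS dG x y; rewrite /dist.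
have dxx z : d z z = 0%N by apply/eqP; rewrite d0.
have dW : walk_of_length (d x y) x y.
  by apply: walk_of_length_exists dS _ _ => u v /eqP; rewrite d0 => /eqP.
set P := fun k => _.
have hP : has P (iota 0 #|G|).
  by apply/hasP; exists (d x y) => //; rewrite mem_iota dG.
apply/eqP; rewrite eqn_leq; apply/andP; split.
  rewrite leqNgt; apply/negP => /(before_find 0%N).
  by rewrite nth_iota // /P dW.
have := nth_find 0%N hP; rewrite has_find size_iota in hP.
by rewrite nth_iota //; apply: walk_of_length_lower.
Qed.

(* Projection of the dumbbell onto the line 0, ..., b+1 that collapses each clique
   to an endpoint: adjacency means distinct vertices at gap at most 1. *)
Definition pos (a b : nat) (x : dumbbell a b) : nat :=
  match x with inl (inl _) => 0 | inl (inr _) => b.+1 | inr i => i.+1 end.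

Definition gap (m n : nat) : nat := ((m - n) + (n - m))%N.

(** The [maxn 1] matters only for distinct vertices of one clique, which share a position yet lie at
    distance 1. *)
Definition pdist (a b : nat) (x y : dumbbell a b) : nat :=
  if x == y then 0%N else maxn 1 (gap (pos x) (pos y)).

Lemma dumbbell_adj_gap (a b : nat) (x y : dumbbell a b) : (0 < b)%N ->
  adj x y = (x != y) && (gap (pos x) (pos y) <= 1)%N.
Proof.
by move=> b0; case: x y => [[i|i]|i] [[j|j]|j];
  rewrite /= ?(inj_eq inl_inj, inj_eq inr_inj) /gap -?val_eqE /=;
  have := ltn_ord i; have := ltn_ord j; lia.
Qed.

Lemma pos_surj (a b k : nat) : (0 < a)%N -> (k <= b.+1)%N ->
  exists x : dumbbell a b, pos x = k.
Proof.
case: a => // a _; case: k => [|k] kb; first by exists (inl (inl ord0)).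
have [kb'|bk] := ltnP k b; first by exists (inr (Ordinal kb')).
by exists (inl (inr ord0)); rewrite /=; lia.
Qed.

Lemma dumbbell_dist (a b : nat) (x y : dumbbell a b) :
  (0 < a)%N -> (0 < b)%N -> dist x y = pdist x y.
Proof.
move=> a0 b0.
have posb (z : dumbbell a b) : (pos z <= b.+1)%N.
  by case: z => [[i|i]|i] //=; apply: ltnW; rewrite ltnS.
apply: dist_unique => {x y} [x y|x y z|x y k|x y].
- by rewrite /pdist; case: (eqVneq x y) => // _; lia.
- rewrite dumbbell_adj_gap // /pdist => /andP[yz].
  case: (eqVneq x z) => // xz; case: (eqVneq x y) => [<-|xy]; rewrite /gap; lia.
- rewrite /pdist; case: (eqVneq x y) => // xy dk.
  have [le1|gt1] := leqP (gap (pos x) (pos y)) 1.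
    exists y; first by rewrite dumbbell_adj_gap // xy.
    by rewrite eqxx; lia.
  (* The next vertex is any one lying one level closer to [y]; the gap exceeds 1, so it differs from
     both ends. *)
  have [z pz] : exists z : dumbbell a b,
      pos z = if (pos x < pos y)%N then (pos x).+1 else (pos x).-1.
    by apply: pos_surj => //; have := posb x; have := posb y; case: ifP; lia.
  have xz : x != z.
    apply: contraTneq gt1 => xz; move: pz; rewrite -xz /gap; case: ifP; lia.
  have zy : z != y.
    apply: contraTneq gt1 => zy; move: pz; rewrite zy /gap; case: ifP; lia.
  exists z; first by rewrite dumbbell_adj_gap // xz /gap pz; case: ifP; lia.
  rewrite (negbTE zy); move: gt1 dk; rewrite /gap pz; case: ifP; lia.
- rewrite card_dumbbell /pdist; have := posb x; have := posb y.
  case: ifP; rewrite /gap; lia.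
Qed.

(** The two cliques contribute [a * i.+1] and [a * (b - i)], together [a * b.+1]; the binomials sum
    the distances to the path vertices on either side. *)
Definition pathw (a b i : nat) : nat :=
  (a * b.+1 + 'C(i.+1, 2) + 'C(b - i, 2))%N.

(** The terms come from the vertex's own clique, the opposite clique, and the path at distances 1 to
    [b]. *)
Definition cliquew (a b : nat) : nat := (a.-1 + a * b.+1 + 'C(b.+1, 2))%N.

Lemma bin2_doubleE (n : nat) : ('C(n.+1, 2) * 2 = n.+1 * n)%N.
Proof. by elim: n => // n IH; rewrite binS bin1 mulnDl IH; lia. Qed.

Lemma sum_gap_ord (b i : nat) : (i < b)%N ->
  (\sum_(j < b) gap i j = 'C(i.+1, 2) + 'C(b - i, 2))%N.
Proof.
move=> ib; rewrite -(big_mkord predT (gap i)) (big_cat_nat _ (n := i)) //=; last exact: ltnW.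
congr (_ + _)%N.
  rewrite big_nat_rev /= -bin2_sum big_nat_recl //= add0n.
  by apply: eq_big_nat => j /andP[_ ji]; rewrite /gap; lia.
rewrite -{1}[i]add0n big_addn -bin2_sum.
by apply: eq_big_nat => j _; rewrite /gap; lia.
Qed.

Lemma transmission_path (a b : nat) (i : 'I_b) :
  (0 < a)%N -> (0 < b)%N -> transmission (inr i : dumbbell a b) = pathw a b i.
Proof.
move=> a0 b0; rewrite /transmission (eq_bigr _ (fun x _ => dumbbell_dist _ _ a0 b0)).
rewrite !big_sumType /= /pdist /=.
rewrite (eq_bigr (fun=> i.+1)) => [|j _]; last by rewrite /gap; lia.
rewrite [X in (_ + X + _)%N](eq_bigr (fun=> (b - i)%N)) => [|j _]; last first.
  by have := ltn_ord i; rewrite /gap; lia.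
rewrite [X in (_ + _ + X)%N](eq_bigr (fun j : 'I_b => gap i j)) => [|j _]; last first.
  by rewrite (inj_eq inr_inj) -val_eqE /= /gap; case: eqP => h; lia.
rewrite !sum_nat_const !card_ord sum_gap_ord // -mulnDr /pathw -addnA.
by congr (_ * _ + _)%N; have := ltn_ord i; lia.
Qed.

Lemma sum1_neq (a : nat) (i : 'I_a) : (\sum_(j < a | j != i) 1 = a.-1)%N.
Proof. by rewrite sum1_card -[X in _ = X.-1](card_ord a) -(cardC1 i). Qed.

Lemma transmission_left (a b : nat) (i : 'I_a) : (0 < a)%N -> (0 < b)%N ->
  transmission (inl (inl i) : dumbbell a b) = cliquew a b.
Proof.
move=> a0 b0; rewrite /transmission (eq_bigr _ (fun x _ => dumbbell_dist _ _ a0 b0)).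
rewrite !big_sumType /= /pdist /= (bigD1 i) //= eqxx add0n.
rewrite (eq_bigr (fun=> 1%N)) => [|j ji]; last first.
  by rewrite !(inj_eq inl_inj) eq_sym (negbTE ji).
rewrite [X in (_ + X + _)%N](eq_bigr (fun=> b.+1)) => [|j _]; last first.
  by rewrite /gap; lia.
rewrite [X in (_ + _ + X)%N](eq_bigr (fun j : 'I_b => j.+1)) => [|j _]; last first.
  by rewrite /gap; lia.
rewrite sum1_neq !sum_nat_const !card_ord.
congr (_ + _)%N; rewrite -bin2_sum big_nat_recl //= add0n.
by rewrite big_mkord.
Qed.

Lemma transmission_right (a b : nat) (i : 'I_a) : (0 < a)%N -> (0 < b)%N ->
  transmission (inl (inr i) : dumbbell a b) = cliquew a b.
Proof.
move=> a0 b0; rewrite /transmission (eq_bigr _ (fun x _ => dumbbell_dist _ _ a0 b0)).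
rewrite !big_sumType /= /pdist /= [X in (_ + X + _)%N](bigD1 i) //= eqxx add0n.
rewrite (eq_bigr (fun=> b.+1)) => [|j _]; last by rewrite /gap; lia.
rewrite [X in (_ + X + _)%N](eq_bigr (fun=> 1%N)) => [|j ji]; last first.
  by rewrite !(inj_eq inl_inj, inj_eq inr_inj) eq_sym (negbTE ji) /gap; lia.
rewrite [X in (_ + _ + X)%N](eq_bigr (fun j : 'I_b => (b - j)%N)) => [|j _]; last first.
  by have := ltn_ord j; rewrite /gap; lia.
rewrite sum1_neq !sum_nat_const !card_ord.
rewrite [(_ + a.-1)%N]addnC; congr (_ + _)%N.
rewrite -bin2_sum big_nat_recl //= add0n -(big_mkord predT (fun j => b - j)%N).
rewrite big_nat_rev /=; apply: eq_big_nat => j; lia.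
Qed.

(** * The sum-Balaban index as a sum over edge types *)

(* Every edge [set x; y] arises from the two ordered pairs (x, y), (y, x). *)
Lemma sum_edges_double (V : nmodType) (G : sgraph) (f : {set G} -> V) :
  \sum_(x : G) \sum_(y : G | adj x y) f [set x; y]%SET =
  (\sum_(E in edges G) f E) *+ 2.
Proof.
rewrite pair_big_dep /=.
rewrite (partition_big (fun p : G * G => [set p.1; p.2]%SET) (mem (edges G))) /=; last first.
  by move=> p adjp; apply/imsetP; exists p; rewrite ?inE.
rewrite -sumrMnl; apply: eq_bigr => E /imsetP[[x y]].
rewrite inE /= => xy ->.
have xNy : x != y by apply: contraTneq xy => ->; rewrite /= adj_irr.
rewrite (bigD1 (x, y)) /=; last by rewrite xy eqxx.
rewrite (bigD1 (y, x)) /=; last first.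
  by rewrite adj_sym xy finset.setUC eqxx /= xpair_eqE negb_and eq_sym xNy.
rewrite big1 ?addr0 => [|[u v]] /=; first by rewrite mulr2n [in X in _ + X]finset.setUC.
case/andP=> /andP[/andP[uv /eqP E1] /negP h1] /negP h2; exfalso.
have uNv : u != v by apply: contraTneq uv => ->; rewrite adj_irr.
have : u \in [set x; y]%SET by rewrite -E1 !inE eqxx.
have : v \in [set x; y]%SET by rewrite -E1 !inE eqxx orbT.
rewrite !inE => /orP[]/eqP ev /orP[]/eqP eu; subst u v.
- by rewrite eqxx in uNv.
- by apply: h2.
- by apply: h1.
- by rewrite eqxx in uNv.
Qed.

Lemma sum_consecutive (V : nmodType) (b : nat) (f : nat -> nat -> V) :
  \sum_(i < b) \sum_(j < b | i.+1 == j) f i j = \sum_(i < b.-1) f i i.+1.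
Proof.
case: b => [|b]; first by rewrite !big_ord0.
rewrite big_ord_recr /= [X in _ + X]big1 ?addr0 => [|j /eqP bj]; last first.
  by have := ltn_ord j; rewrite -bj ltnn.
apply: eq_bigr => i _; rewrite (big_pred1 (lift ord0 i)) //=.
Qed.

Lemma sum_adjacent (V : nmodType) (b : nat) (f : nat -> nat -> V) :
  (forall i j, f i j = f j i) ->
  \sum_(i < b) \sum_(j < b | (i.+1 == j) || (j.+1 == i)) f i j =
  (\sum_(i < b.-1) f i i.+1) *+ 2.
Proof.
move=> fC; rewrite mulr2n -!sum_consecutive [X in _ = _ + X](exchange_big_dep xpredT) //=.
rewrite -big_split /=; apply: eq_bigr => i _.
rewrite (bigID (fun j : 'I_b => i.+1 == j)) /=; congr (_ + _).
  by apply: eq_bigl => j; case: eqP => //=; rewrite andbF.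
apply: eq_big => [j|j _]; last exact: fC.
by case: (eqVneq j.+1 i) => [<-|_]; rewrite ?orbT ?orbF ?andbN //= gtn_eqF.
Qed.

(** Consecutive triangular numbers add up to a square, once on each side of the edge. *)
Lemma pathwS (a b j : nat) : (j.+1 < b)%N ->
  (pathw a b j + pathw a b j.+1 = 2 * (a * b.+1) + j.+1 ^ 2 + (b - j.+1) ^ 2)%N.
Proof.
move=> jb; pose d := (b - j.+2)%N; have bE : b = (j + d).+2 by rewrite /d; lia.
have -> : (b - j.+1 = d.+1)%N by lia.
rewrite /pathw; have -> : (b - j = d.+2)%N by lia.
have -> : (b - j.+1 = d.+1)%N by lia.
move: (bin2_doubleE j) (bin2_doubleE j.+1) (bin2_doubleE d) (bin2_doubleE d.+1).
by rewrite -!mulnn; move: (a * b.+1)%N 'C(_, _) 'C(_, _) 'C(_, _) 'C(_, _); lia.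
Qed.

(** An arbitrary [F] serves both the edge count ([F] constantly 1) and the index. The proof
    evaluates the sum over ordered adjacent pairs, block by block, and cancels the factor 2. *)
Lemma sum_edges_dumbbell (R : numDomainType) (a b : nat) (F : nat -> R) :
  (0 < a)%N -> (0 < b)%N ->
  \sum_(E in edges (dumbbell a b)) F (\sum_(u in E) transmission u)%N =
  F (2 * cliquew a b)%N *+ (a * a.-1) + F (cliquew a b + pathw a b 0)%N *+ (2 * a) +
  \sum_(j < b.-1) F (2 * (a * b.+1) + j.+1 ^ 2 + (b - j.+1) ^ 2)%N.
Proof.
move=> a0 b0; apply: (@mulIf _ 2); first by rewrite pnatr_eq0.
rewrite [LHS]mulr_natr -sum_edges_double.
set c := cliquew a b; set p := pathw a b.
pose w (x : dumbbell a b) := match x with inr i => p i | _ => c end.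
have wE (x : dumbbell a b) : transmission x = w x.
  case: x => [[i|i]|i];
  [exact: transmission_left|exact: transmission_right|exact: transmission_path].
have wE2 x y : adj x y -> (\sum_(u in [set x; y]%SET) transmission u = w x + w y)%N.
  move=> xy; rewrite big_setU1 ?big_set1 ?wE // inE.
  by apply: contraTneq xy => ->; rewrite adj_irr.
under eq_bigr => x _ do under eq_bigr => y xy do rewrite (wE2 _ _ xy).
(* Mirror symmetry: both ends of the path have the same transmission. *)
have plast : p b.-1 = p 0%N.
  rewrite /p /pathw prednK // subn0 (_ : b - b.-1 = 1)%N; last lia.
  by rewrite -!addnA [('C(b, 2) + _)%N]addnC.
have cliques : \sum_(i < a) \sum_(j < a | i != j) F (2 * c)%N = F (2 * c)%N *+ (a * a.-1).
  under eq_bigr => i _.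
    rewrite sumr_const -sum1_card.
    rewrite (eq_bigl (fun j => j != i)); last by move=> j; rewrite unfold_in /= [j == i]eq_sym.
    rewrite sum1_neq; over.
  by rewrite sumr_const card_ord -mulrnA [(a.-1 * a)%N]mulnC.
have joinl : \sum_(i < a) \sum_(j < b | j == 0 :> nat) F (c + p j)%N = F (c + p 0%N)%N *+ a.
  under eq_bigr => i _ do rewrite (big_pred1 (Ordinal b0)) //.
  by rewrite sumr_const card_ord.
have joinr : \sum_(i < a) \sum_(j < b | j == b.-1 :> nat) F (c + p j)%N = F (c + p 0%N)%N *+ a.
  have b1 : (b.-1 < b)%N by rewrite prednK.
  under eq_bigr => i _ do rewrite (big_pred1 (Ordinal b1)) //= plast.
  by rewrite sumr_const card_ord.
have joinl' : \sum_(j < b) \sum_(i < a | j == 0 :> nat) F (p j + c)%N = F (c + p 0%N)%N *+ a.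
  rewrite (exchange_big_dep xpredT) //= -joinl.
  by apply: eq_bigr => i _; apply: eq_bigr => j _; rewrite addnC.
have joinr' : \sum_(j < b) \sum_(i < a | j == b.-1 :> nat) F (p j + c)%N = F (c + p 0%N)%N *+ a.
  rewrite (exchange_big_dep xpredT) //= -joinr.
  by apply: eq_bigr => i _; apply: eq_bigr => j _; rewrite addnC.
rewrite !big_sumType /=.
under [X in X + _ + _]eq_bigr => i _.
  rewrite !big_sumType /= big_pred0_eq addr0 addnn -mul2n; over.
under [X in _ + X + _]eq_bigr => i _.
  rewrite !big_sumType /= big_pred0_eq add0r addnn -mul2n; over.
under [X in _ + _ + X]eq_bigr => i _ do rewrite !big_sumType /=.
rewrite !big_split /= cliques joinl joinr joinl' joinr'.
rewrite (sum_adjacent b (f := fun i j => F (p i + p j)%N)) => [|i j]; last first.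
  by rewrite addnC.
under [X in X *+ 2]eq_bigr => j _.
  rewrite pathwS; last by have := ltn_ord j; lia.
  over.
move: (F _) (F _) (\sum_(j < _) _) => X Y Z.
by rewrite mul2n -addnn mulrnDr; move: (X *+ _) (Y *+ _) => X' Y'; ring.
Qed.

Lemma card_edges_dumbbell (a b : nat) : (0 < a)%N -> (0 < b)%N ->
  #|edges (dumbbell a b)| = (a * a.+1 + b.-1)%N.
Proof.
move=> a0 b0; apply/eqP; rewrite -(eqr_nat int) -sum1_card natr_sum.
rewrite (sum_edges_dumbbell (R := int) (fun=> 1)) //.
rewrite sumr_const card_ord -!mulrnDr; apply/eqP; congr (_ *+ _); nia.
Qed.

Lemma sum_Balaban_dumbbell (R : realType) (a b : nat) : (0 < a)%N -> (0 < b)%N ->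
  sum_Balaban R (dumbbell a b) =
  (a * a.+1 + b.-1)%:R / (a * a.-1).+1%:R *
  ((a * a.-1)%:R / Num.sqrt (2 * cliquew a b)%:R +
   (2 * a)%:R / Num.sqrt (cliquew a b + pathw a b 0)%:R +
   \sum_(j < b.-1) (Num.sqrt (2 * (a * b.+1) + j.+1 ^ 2 + (b - j.+1) ^ 2)%:R)^-1).
Proof.
move=> a0 b0; rewrite /sum_Balaban card_edges_dumbbell // card_dumbbell.
rewrite (sum_edges_dumbbell (fun k => (Num.sqrt k%:R)^-1 : R)) //.
congr (_ / _ * _); last by rewrite !mulr_natl.
(* Here m - n + 2 = a(a+1) + (b-1) - (2a+b) + 2 = a(a-1) + 1. *)
by apply/eqP; rewrite addrAC subr_eq -!natrD eqr_nat; nia.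
Qed.

(** * The path sum as a Riemann sum *)

(** An antiderivative of 1/sqrt(1+x^2), used to evaluate the limiting integral on [-1, 1]. *)
Definition asinh (R : realType) (x : R) : R := ln (x + Num.sqrt (1 + x ^+ 2)).

Lemma sqrt1Dsqr_ge1 (R : realType) (x : R) : 1 <= Num.sqrt (1 + x ^+ 2).
Proof. by rewrite -[X in X <= _]sqrtr1 ler_wsqrtr // lerDl sqr_ge0. Qed.

Lemma sqr_sqrt1Dsqr (R : realType) (x : R) :
  Num.sqrt (1 + x ^+ 2) ^+ 2 = 1 + x ^+ 2.
Proof. by rewrite sqr_sqrtr // addr_ge0 ?sqr_ge0. Qed.

Lemma norm_le_sqrt1Dsqr (R : realType) (x : R) : `|x| < Num.sqrt (1 + x ^+ 2).
Proof. by rewrite -sqrtr_sqr ltr_sqrt ?ltrDr // ltr_pwDl ?sqr_ge0. Qed.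

Lemma is_derive_asinh (R : realType) (x : R) :
  is_derive x 1 (@asinh R) (Num.sqrt (1 + x ^+ 2))^-1.
Proof.
have s0 : 0 < 1 + x ^+ 2 by rewrite ltr_pwDl ?sqr_ge0.
have p0 : 0 < x + Num.sqrt (1 + x ^+ 2).
  by have := norm_le_sqrt1Dsqr x; rewrite ltr_norml => /andP[]; lra.
have d1 : is_derive x 1 (fun y : R => 1 + y ^+ 2) (2 * x).
  apply: is_derive_eq; rewrite add0r scaler1 /=; ring.
have d2 : is_derive x 1 (fun y : R => Num.sqrt (1 + y ^+ 2)) _ :=
  @is_derive1_comp R Num.sqrt (fun y => 1 + y ^+ 2) x _ _ (is_derive1_sqrt s0) d1.
have d3 : is_derive x 1 (fun y : R => y + Num.sqrt (1 + y ^+ 2)) _ :=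
  is_deriveD (is_derive_id x 1) d2.
have d4 : is_derive x 1 (@asinh R) _ :=
  @is_derive1_comp R (@ln R) _ x _ _ (is_derive1_ln p0) d3.
apply: (is_derive_eq d4).
have := sqrt1Dsqr_ge1 x; move: p0; set s := Num.sqrt _ => p0 s1.
by field; rewrite !gt_eqF //; lra.
Qed.

(** With u and v the two roots, u - v = (x-y)(x+y)/(u+v), where |x+y| <= u+v. Dividing by uv >= 1
    preserves the bound. *)
Lemma inv_sqrt1Dsqr_lipschitz (R : realType) (x y : R) :
  `|(Num.sqrt (1 + x ^+ 2))^-1 - (Num.sqrt (1 + y ^+ 2))^-1| <= `|x - y|.
Proof.
have := sqrt1Dsqr_ge1 x; have := sqrt1Dsqr_ge1 y.
have := norm_le_sqrt1Dsqr x; have := norm_le_sqrt1Dsqr y.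
have := sqr_sqrt1Dsqr x; have := sqr_sqrt1Dsqr y.
set u := Num.sqrt (1 + x ^+ 2); set v := Num.sqrt (1 + y ^+ 2).
move=> vE uE yv xu v1 u1.
have u0 : 0 < u by lra.
have v0 : 0 < v by lra.
have uv : u - v = (x - y) * ((x + y) / (u + v)).
  rewrite mulrA (_ : (x - y) * (x + y) = (u - v) * (u + v)); last first.
    by rewrite -!subr_sqr uE vE; ring.
  by rewrite mulfK // gt_eqF // addr_gt0.
have uvle : `|u - v| <= `|x - y|.
  rewrite uv normrM ler_piMr // normrM normfV ler_pdivrMr ?normr_gt0 ?gt_eqF ?addr_gt0 //.
  rewrite mul1r (ger0_norm (addr_ge0 (ltW u0) (ltW v0))).
  by apply: le_trans (ler_normD _ _) _; lra.
have -> : u^-1 - v^-1 = (v - u) / (u * v) by field; rewrite !gt_eqF.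
rewrite normrM normfV distrC (ger0_norm (mulr_ge0 (ltW u0) (ltW v0))).
rewrite ler_pdivrMr ?mulr_gt0 //; apply: le_trans uvle _.
by rewrite ler_peMr //; nra.
Qed.

(** The mean value theorem gives the slope at an intermediate point; the Lipschitz bound moves it to
    the left endpoint. *)
Lemma asinh_step (R : realType) (x y : R) : x < y ->
  `|asinh y - asinh x - (Num.sqrt (1 + x ^+ 2))^-1 * (y - x)| <= (y - x) ^+ 2.
Proof.
move=> xy.
have [z _||z] := @MVT R (@asinh R) (fun z => (Num.sqrt (1 + z ^+ 2))^-1) x y xy.
- exact: is_derive_asinh.
- by apply: derivable_within_continuous => z _; case: (is_derive_asinh z).
rewrite in_itv /= => /andP[xz zy] ->.
have yx0 : 0 <= y - x by rewrite subr_ge0 ltW.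
rewrite -mulrBl normrM expr2 [X in _ * X]ger0_norm // ler_wpM2r //.
apply: le_trans (inv_sqrt1Dsqr_lipschitz _ _) _.
by rewrite ger0_norm; lra.
Qed.

Lemma asinh1 (R : realType) : asinh (1 : R) = ln (1 + Num.sqrt 2).
Proof. by rewrite /asinh expr1n. Qed.

Lemma asinhN1 (R : realType) : asinh (-1 : R) = - ln (1 + Num.sqrt 2).
Proof.
have s0 : 0 < 1 + Num.sqrt 2 :> R by rewrite ltr_pwDl ?sqrtr_ge0.
rewrite /asinh sqrrN expr1n -lnV ?posrE //; congr ln.
apply: (mulIf (lt0r_neq0 s0)); rewrite mulVf ?lt0r_neq0 //.
by have := @sqr_sqrtr R 2 (ler0n _ _); rewrite -[1 + 1]/2; lra.
Qed.

(** The path part of the index with the clique contribution [2 * (a * b.+1)] removed from under the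
    roots. *)
Definition path_sum (R : realType) (b : nat) : R :=
  \sum_(j < b.-1) (Num.sqrt (j.+1 ^ 2 + (b - j.+1) ^ 2)%:R)^-1.

Definition Qconst (R : realType) : R := Num.sqrt 2 * ln (1 + Num.sqrt 2).

(* With y_j = (2j - b)/b, the summand is (2/b) / sqrt (2 (1 + y_j^2)): up to its
   missing term at j = 0, sqrt 2 times the sum is a left Riemann sum of
   1 / sqrt (1 + y^2) on [-1, 1] with mesh 2/b. *)
Lemma path_sum_estimate (R : realType) (b : nat) : (0 < b)%N ->
  `|path_sum R b - Qconst R| <= 6 / b%:R.
Proof.
case: b => // b _; pose h : R := 2 / b.+1%:R.
have b0 : 0 < b.+1%:R :> R by rewrite ltr0n.
have h0 : 0 < h by rewrite divr_gt0.
pose y (j : nat) : R := h * j%:R - 1.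
have yS j : y j.+1 - y j = h by rewrite /y -natr1; ring.
pose k (x : R) := (Num.sqrt (1 + x ^+ 2))^-1.
have s2 : 0 < Num.sqrt 2 :> R by rewrite sqrtr_gt0.
have s21 : 1 <= Num.sqrt 2 :> R by rewrite -[X in X <= _]sqrtr1 ler_wsqrtr // ler1n.
have s2s : Num.sqrt 2 ^+ 2 = 2 :> R by rewrite sqr_sqrtr.
have term (j : nat) : (j <= b.+1)%N ->
    (Num.sqrt (j ^ 2 + (b.+1 - j) ^ 2)%:R)^-1 * Num.sqrt 2 = k (y j) * h.
  move=> jb; have -> : (j ^ 2 + (b.+1 - j) ^ 2)%:R = (1 + y j ^+ 2) * (Num.sqrt 2 / h) ^+ 2 :> R.
    rewrite expr_div_n s2s natrD !natrX natrB // /y /h.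
    by field; rewrite gt_eqF.
  rewrite sqrtrM ?addr_ge0 ?sqr_ge0 // sqrtr_sqr gtr0_norm ?divr_gt0 // /k.
  have := sqrt1Dsqr_ge1 (y j); set u := Num.sqrt (1 + _) => u1.
  by field; rewrite !gt_eqF //=; lra.
have step j : `|asinh (y j.+1) - asinh (y j) - k (y j) * h| <= h ^+ 2.
  by rewrite -(yS j) asinh_step // -subr_gt0 yS.
have total : `|2 * ln (1 + Num.sqrt 2) - \sum_(j < b.+1) k (y j) * h| <= b.+1%:R * h ^+ 2.
  have -> : 2 * ln (1 + Num.sqrt 2) = \sum_(j < b.+1) (asinh (y j.+1) - asinh (y j)).
    rewrite -(big_mkord predT (fun j => asinh (y j.+1) - asinh (y j))) telescope_sumr //.
    rewrite /y (_ : h * b.+1%:R - 1 = 1) ?mulr0 ?sub0r; last first.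
      by rewrite /h divfK ?gt_eqF //; ring.
    by rewrite asinh1 asinhN1; ring.
  rewrite -sumrB; apply: le_trans (ler_norm_sum _ _ _) _.
  rewrite mulr_natl -[X in _ *+ X]card_ord -sumr_const.
  by apply: ler_sum => j _; exact: step.
rewrite big_ord_recl in total.
have path : \sum_(j < b) k (y (lift ord0 j)) * h = path_sum R b.+1 * Num.sqrt 2.
  by rewrite mulr_suml; apply: eq_bigr => j _; rewrite lift0 -(term j.+1) // ltnS ltnW.
rewrite path in total.
(* The Riemann term at j = 0 has no counterpart in [path_sum]; it costs at most one mesh width. *)
have k0 : 0 <= k (y 0%N) * h <= h.
  have := sqrt1Dsqr_ge1 (y 0%N) => u1; have u0 := lt_le_trans ltr01 u1.
  rewrite mulr_ge0 ?invr_ge0 ?(ltW u0) ?(ltW h0) //=.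
  by rewrite ler_piMl ?(ltW h0) // invf_le1.
have hE : b.+1%:R * h ^+ 2 = 2 * h by rewrite /h; field; rewrite gt_eqF.
(* The error 3h consists of 2h from the b+1 steps of error h^2 and h from the missing term. *)
have -> : 6 / b.+1%:R = 3 * h by rewrite /h; field; rewrite gt_eqF.
have diff : (path_sum R b.+1 - Qconst R) * Num.sqrt 2 =
    path_sum R b.+1 * Num.sqrt 2 - 2 * ln (1 + Num.sqrt 2).
  by rewrite /Qconst mulrBl [X in _ - X]mulrAC -expr2 s2s.
have : `|path_sum R b.+1 - Qconst R| * Num.sqrt 2 <= 3 * h.
  rewrite -{1}(gtr0_norm s2) -normrM diff; move: total k0; rewrite hE /=.
  by rewrite !ler_norml => /andP[? ?] /andP[? ?]; apply/andP; split; lra.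
by apply: le_trans; rewrite ler_peMr.
Qed.

(** * Bounds on the index *)

Lemma dumbbell_prefactor (R : realType) (a b : nat) : (0 < a)%N -> (0 < b)%N ->
  (a * a.+1 + b.-1)%:R / (a * a.-1).+1%:R =
  1 + ((2 * a + b)%:R - 2) / (a%:R ^+ 2 - a%:R + 1) :> R.
Proof.
case: a b => // a [] // b _ _.
have a0 : 0 <= a%:R :> R by rewrite ler0n.
rewrite /= -[(_ * a).+1]addn1 !(natrD, natrM) -!natr1.
by field; rewrite gt_eqF; nra.
Qed.

Lemma sqr_nat_gt0 (R : realType) (b j : nat) : (0 < b)%N ->
  0 < (j.+1 ^ 2 + (b - j.+1) ^ 2)%:R :> R.
Proof. by rewrite ltr0n; lia. Qed.

Lemma cliquew_double (a b : nat) :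
  (2 * cliquew a b = 2 * a.-1 + 2 * (a * b.+1) + b * b.+1)%N.
Proof. by rewrite /cliquew; have := bin2_doubleE b; lia. Qed.

Lemma cliquew_pathw (a b : nat) :
  (cliquew a b + pathw a b 0 = a.-1 + 2 * (a * b.+1) + b ^ 2)%N.
Proof.
rewrite /cliquew /pathw subn0 (@bin_small 1 2) // -mulnn.
case: b => [|b]; first by rewrite !bin_small //; lia.
by have := bin2_doubleE b; have := bin2_doubleE b.+1; lia.
Qed.

Lemma path_sum_ge0 (R : realType) (b : nat) : 0 <= path_sum R b.
Proof. by apply: sumr_ge0 => j _; rewrite invr_ge0 sqrtr_ge0. Qed.

Lemma ler_inv_sqrt_nat (R : realType) (m n : nat) : (0 < m)%N -> (m <= n)%N ->
  (Num.sqrt n%:R)^-1 <= (Num.sqrt m%:R)^-1 :> R.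
Proof.
move=> m0 mn; rewrite lef_pV2 ?posrE ?sqrtr_gt0 ?ltr0n ?(leq_trans m0) //.
by rewrite ler_wsqrtr // ler_nat.
Qed.

Lemma sqrt_natX2 (R : realType) (n : nat) : Num.sqrt (n ^ 2)%:R = n%:R :> R.
Proof. by rewrite natrX sqrtr_sqr ger0_norm. Qed.

(** Each of the a^2 + a edges meeting a clique has transmission sum at least b^2, and on the path
    edges the term 2a(b+1) is discarded. *)
Lemma sum_Balaban_upper (R : realType) (a b : nat) : (0 < a)%N -> (0 < b)%N ->
  sum_Balaban R (dumbbell a b) <=
  (1 + ((2 * a + b)%:R - 2) / (a%:R ^+ 2 - a%:R + 1)) *
  ((a%:R ^+ 2 + a%:R) / b%:R + path_sum R b).
Proof.
move=> a0 b0; rewrite sum_Balaban_dumbbell // -dumbbell_prefactor //.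
have bb : (0 < b ^ 2)%N by rewrite expn_gt0 b0.
rewrite ler_wpM2l ?divr_ge0 // lerD //; last first.
  apply: ler_sum => j _; apply: ler_inv_sqrt_nat; last by lia.
  by rewrite -(ltr0n R) sqr_nat_gt0.
have -> : a%:R ^+ 2 + a%:R = (a * a.-1)%:R + (2 * a)%:R :> R.
  by rewrite -natrX -!natrD; congr (_%:R); nia.
rewrite mulrDl -(sqrt_natX2 R b) lerD // ler_wpM2l // ler_inv_sqrt_nat //.
  by rewrite cliquew_double; nia.
by rewrite cliquew_pathw; nia.
Qed.

(** Edges meeting a clique have transmission sum at most (2a+b)^2, and there are at least a^2 of
    them; in the prefactor, a^2 - a + 1 <= a^2. *)
Lemma sum_Balaban_lower (R : realType) (a b : nat) (S : R) :
  (0 < a)%N -> (0 < b)%N ->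
  0 <= a%:R ^+ 2 / (2 * a + b)%:R + S ->
  S <= \sum_(j < b.-1) (Num.sqrt (2 * (a * b.+1) + j.+1 ^ 2 + (b - j.+1) ^ 2)%:R)^-1 ->
  (1 + ((2 * a + b)%:R - 2) / a%:R ^+ 2) * (a%:R ^+ 2 / (2 * a + b)%:R + S) <=
  sum_Balaban R (dumbbell a b).
Proof.
move=> a0 b0 S0 Sle; rewrite sum_Balaban_dumbbell // dumbbell_prefactor //.
have a1 : 1 <= a%:R :> R by rewrite ler1n.
have n2 : 0 <= (2 * a + b)%:R - 2 :> R by rewrite subr_ge0 ler_nat; lia.
apply: ler_pM => //; first by rewrite addr_ge0 // divr_ge0 // sqr_ge0.
  rewrite lerD2l ler_wpM2l // lef_pV2 ?posrE; nra.
apply: lerD => //.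
have n0 : (0 < 2 * cliquew a b)%N by rewrite cliquew_double; nia.
have m0 : (0 < cliquew a b + pathw a b 0)%N by rewrite cliquew_pathw; nia.
apply: (@le_trans _ _ ((a * a.-1)%:R / (2 * a + b)%:R + (2 * a)%:R / (2 * a + b)%:R)).
  by rewrite -mulrDl ler_wpM2r ?invr_ge0 // -natrX -natrD ler_nat; nia.
rewrite -(sqrt_natX2 R (2 * a + b)) lerD // ler_wpM2l // ler_inv_sqrt_nat //.
  by rewrite cliquew_double -mulnn; nia.
by rewrite cliquew_pathw -mulnn; nia.
Qed.

(** For z < 1, sqrt(A+s) <= sqrt(s)(1+z) and (1-z)(1+z) <= 1; for z >= 1 the left side is
    nonpositive. *)
Lemma inv_sqrtD_lower (R : realType) (A s z : R) : 0 < s -> 0 <= A -> 0 <= z ->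
  A <= z * s -> (Num.sqrt s)^-1 * (1 - z) <= (Num.sqrt (A + s))^-1.
Proof.
move=> s0 A0 z0 Az.
have r0 : 0 < Num.sqrt s by rewrite sqrtr_gt0.
have [z1|z1] := leP 1 z.
  by apply: (@le_trans _ _ 0); rewrite ?invr_ge0 ?sqrtr_ge0 // mulr_ge0_le0 ?invr_ge0 ?sqrtr_ge0 //; lra.
have q0 : 0 < Num.sqrt (A + s) by rewrite sqrtr_gt0; lra.
have q : Num.sqrt (A + s) <= Num.sqrt s * (1 + z).
  rewrite -[X in _ <= _ * X]ger0_norm; last lra.
  by rewrite -sqrtr_sqr -sqrtrM ?(ltW s0) // ler_wsqrtr //; nra.
rewrite mulrC ler_pdivrMr // mulrC ler_pdivlMr //.
nra.
Qed.

(** The relative perturbation is bounded using j^2 + (b-j)^2 >= b^2/2, so that (8a/b)(b^2/2) = 4ab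
    >= 2a(b+1). *)
Lemma path_part_lower (R : realType) (a b : nat) : (0 < b)%N ->
  path_sum R b * (1 - 8 * a%:R / b%:R) <=
  \sum_(j < b.-1) (Num.sqrt (2 * (a * b.+1) + j.+1 ^ 2 + (b - j.+1) ^ 2)%:R)^-1.
Proof.
move=> b0; rewrite mulr_suml; apply: ler_sum => j _.
have jb : (j.+1 <= b)%N by have := ltn_ord j; lia.
have b1 : 1 <= b%:R :> R by rewrite ler1n.
have a0 : 0 <= a%:R :> R by rewrite ler0n.
rewrite -addnA [X in _ <= (Num.sqrt X)^-1]natrD; apply: inv_sqrtD_lower; rewrite ?sqr_nat_gt0 //.
rewrite mulrAC ler_pdivlMr ?ltr0n // natrD !natrX natrB // !natrM -natr1.
set x := j.+1%:R : R.
have : b%:R ^+ 2 <= 2 * (x ^+ 2 + (b%:R - x) ^+ 2) by have := sqr_ge0 (2 * x - b%:R); lra.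
set y := x ^+ 2 + _; rewrite -subr_ge0 => /(mulr_ge0 a0) h.
have : 0 <= a%:R * b%:R * (b%:R - 1) :> R by rewrite !mulr_ge0 ?subr_ge0.
lra.
Qed.

(** * Bounds on the index in rescaled variables *)

(** The bound of [sum_Balaban_upper] after substituting n = 1/r^2, a = x/r, b = (1-2xr)/r^2 and
    estimating [path_sum] by Q + 6/b. *)
Definition scaled_upper (R : realType) (Q r x : R) : R :=
  (1 + (1 - 2 * r ^+ 2) / (x ^+ 2 - x * r + r ^+ 2)) *
  ((x ^+ 2 + x * r + 6 * r ^+ 2) / (1 - 2 * x * r) + Q).

(** When 1/b <= 2r^2 and x <= K, the path sum lies within 12r^2 of Q and the damping 8a/b is at most
    16Kr. *)
Definition scaled_path_lower (R : realType) (Q K r : R) : R :=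
  Q - 12 * r ^+ 2 - 16 * K * r * (Q + 12 * r ^+ 2).

(* Rescaled variables r = 1 / sqrt n and x = a / sqrt n. *)
Lemma sum_Balaban_scaled_upper (R : realType) (a b n : nat) :
  (0 < a)%N -> (0 < b)%N -> (2 * a + b = n)%N ->
  sum_Balaban R (dumbbell a b) <=
  scaled_upper (Qconst R) (Num.sqrt n%:R)^-1 (a%:R / Num.sqrt n%:R).
Proof.
move=> a0 b0 nE; apply: le_trans (sum_Balaban_upper R a0 b0) _; rewrite nE.
have n0 : 0 < n%:R :> R by rewrite ltr0n -nE addn_gt0 b0 orbT.
have s0 : 0 < Num.sqrt n%:R :> R by rewrite sqrtr_gt0.
have sE := sqr_sqrtr (ltW n0); move: s0 sE; set s := Num.sqrt n%:R => s0 sE.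
have bE : b%:R = s ^+ 2 - 2 * a%:R by rewrite sE -nE natrD natrM; ring.
have a1 : 1 <= a%:R :> R by rewrite ler1n.
have b1 : 1 <= b%:R :> R by rewrite ler1n.
have sn : 2 <= s ^+ 2 by lra.
have d0 : 0 < a%:R ^+ 2 - a%:R + 1 :> R by nra.
have pE := le_trans (ler_norm _) (path_sum_estimate R b0).
have -> : scaled_upper (Qconst R) s^-1 (a%:R / s) =
    (1 + (n%:R - 2) / (a%:R ^+ 2 - a%:R + 1)) *
    ((a%:R ^+ 2 + a%:R) / b%:R + (Qconst R + 6 / b%:R)).
  by rewrite /scaled_upper -sE bE; field; rewrite !gt_eqF //=; nra.
rewrite ler_wpM2l ?lerD2l //; last by move: pE; lra.
by rewrite addr_ge0 // divr_ge0 ?(ltW d0) // -sE; lra.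
Qed.

Lemma sum_Balaban_scaled_lower (R : realType) (a b n : nat) (K : R) :
  (0 < a)%N -> (0 < b)%N -> (2 * a + b = n)%N ->
  let r := (Num.sqrt n%:R)^-1 in
  let x := a%:R / Num.sqrt n%:R in
  let S := scaled_path_lower (Qconst R) K r in
  x <= K -> 4 * K * r <= 1 -> 0 <= S ->
  (1 + (1 - 2 * r ^+ 2) / x ^+ 2) * (x ^+ 2 + S) <= sum_Balaban R (dumbbell a b).
Proof.
move=> a0 b0 nE r x S xK Kr S0.
have n0 : 0 < n%:R :> R by rewrite ltr0n -nE addn_gt0 b0 orbT.
have s0 : 0 < Num.sqrt n%:R :> R by rewrite sqrtr_gt0.
have sE := sqr_sqrtr (ltW n0).
have a1 : 1 <= a%:R :> R by rewrite ler1n.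
have b1 : 1 <= b%:R :> R by rewrite ler1n.
have r0 : 0 < r by rewrite invr_gt0.
have x0 : 0 < x by rewrite divr_gt0 //; lra.
have bE : b%:R = (1 - 2 * x * r) / r ^+ 2.
  have -> : b%:R = n%:R - 2 * a%:R :> R by rewrite -nE natrD natrM; ring.
  by rewrite -sE /x /r; field; rewrite gt_eqF.
(* This makes b at least n/2, whence 1/b <= 2r^2. *)
have xr : 2 * x * r <= 2^-1 by nra.
have ib : b%:R^-1 <= 2 * r ^+ 2 :> R.
  rewrite bE invf_div ler_pdivrMr; last by lra.
  by have := sqr_ge0 r; nra.
have ib0 : 0 < b%:R^-1 :> R by rewrite invr_gt0; lra.
have ar : a%:R = x / r by rewrite /x /r invrK divfK // gt_eqF.
have ab : 8 * a%:R / b%:R <= 16 * K * r.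
  rewrite ar; apply: (@le_trans _ _ (8 * (x / r) * (2 * r ^+ 2))).
    by rewrite ler_wpM2l // mulr_ge0 // divr_ge0 // ltW.
  have -> : 8 * (x / r) * (2 * r ^+ 2) = 16 * x * r by field; rewrite gt_eqF.
  by nra.
have := path_sum_estimate R b0; rewrite ler_norml => /andP[pl pu].
have tE : x ^+ 2 = a%:R ^+ 2 / (2 * a + b)%:R by rewrite nE -sE /x expr_div_n.
have cE : 1 + (1 - 2 * r ^+ 2) / x ^+ 2 = 1 + ((2 * a + b)%:R - 2) / a%:R ^+ 2.
  rewrite nE -sE /x /r; field; rewrite !gt_eqF //=; lra.
rewrite cE tE; apply: sum_Balaban_lower => //.
  by rewrite addr_ge0 // divr_ge0 // sqr_ge0.
apply: le_trans (path_part_lower R a b0).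
have p0 := path_sum_ge0 R b; move: pl pu p0 ab.
have ab0 : 0 <= 8 * a%:R / b%:R :> R by rewrite divr_ge0 ?mulr_ge0.
move: ab0; rewrite /S /scaled_path_lower.
set P := path_sum R b; set z := 8 * a%:R / _; set Q := Qconst R.
move=> z0 pl pu p0 zK.
(* In P(1-z) = P - Pz, the first P is bounded from below and the second from above. *)
have : P * z <= (Q + 12 * r ^+ 2) * (16 * K * r) by apply: ler_pM => //; lra.
lra.
Qed.

(* For e = 1 and S = c^4 the function (1 + e/t)(t + S) has minimum
   (1 + c^2)^2 at t = c^2; the right-hand side measures the perturbation. *)
Lemma near_minimum (R : realType) (c K U e S t : R) :
  0 < t -> t <= K -> (1 + e / t) * (t + S) <= U ->
  (t - c ^+ 2) ^+ 2 <= `|U - e - S - 2 * c ^+ 2| * K + `|c ^+ 4 - e * S|.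
Proof.
move=> t0 tK h; have {}h : (t + e) * (t + S) <= U * t.
  have -> : (t + e) * (t + S) = (1 + e / t) * (t + S) * t by field; rewrite gt_eqF.
  by rewrite ler_wpM2r // ltW.
(* The first difference on the right is nonpositive by [h]; the other two summands are the
   perturbation. *)
have -> : (t - c ^+ 2) ^+ 2 =
  (t + e) * (t + S) - U * t + (U - e - S - 2 * c ^+ 2) * t + (c ^+ 4 - e * S) by ring.
apply: lerD; last exact: ler_norm.
apply: (@le_trans _ _ ((U - e - S - 2 * c ^+ 2) * t)); first by lra.
apply: (@le_trans _ _ (`|U - e - S - 2 * c ^+ 2| * t)).
  by rewrite ler_wpM2r ?(ltW t0) // ler_norm.
by rewrite ler_wpM2l.
Qed.

(** * Asymptotics of the minimizer *)

Lemma cvg_inv_sqrt_nat (R : realType) :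
  (fun n : nat => (Num.sqrt n%:R)^-1 : R) @ \oo --> (0 : R).
Proof.
apply/cvgrPdist_lt => e e0; near=> n.
have n0 : 0 < n%:R :> R by rewrite ltr0n; near: n; exists 1%N.
have ne : e ^- 2 < n%:R.
  near: n; exists (Num.truncn (e ^- 2)).+1 => // m /= me.
  by apply: lt_le_trans (truncnS_gt _) _; rewrite ler_nat.
rewrite sub0r normrN ger0_norm ?invr_ge0 ?sqrtr_ge0 //.
rewrite invf_plt ?posrE ?sqrtr_gt0 // -[X in X < _]ger0_norm ?invr_ge0 ?ltW //.
by rewrite -sqrtr_sqr exprVn ltr_sqrt.
Unshelve. all: by end_near. Qed.

Lemma cvg_scaled_upper (R : realType) (c Q : R) (r x : R^nat) : 0 < c ->
  r @ \oo --> (0 : R) -> x @ \oo --> c ->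
  (fun n => scaled_upper Q (r n) (x n)) @ \oo --> (1 + 1 / c ^+ 2) * (c ^+ 2 + Q).
Proof.
move=> c0 r0 xc.
have r2 : (fun n => r n ^+ 2) @ \oo --> (0 : R).
  by rewrite -(mulr0 0); exact: cvgM.
have x2 : (fun n => x n ^+ 2) @ \oo --> c ^+ 2 by exact: cvgM.
have xr : (fun n => x n * r n) @ \oo --> (0 : R).
  by rewrite -(mulr0 c); exact: cvgM.
rewrite /scaled_upper.
(* The limit is spelled out in the shape of [scaled_upper], so that the limit rules apply term by
   term. *)
have -> : (1 + 1 / c ^+ 2) * (c ^+ 2 + Q) =
    (1 + (1 - 2 * 0) / (c ^+ 2 - 0 + 0)) * ((c ^+ 2 + 0 + 6 * 0) / (1 - 2 * 0) + Q).
  by field; rewrite gt_eqF.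
have d0 : c ^+ 2 - 0 + 0 != 0 by rewrite subr0 addr0 expf_neq0 // gt_eqF.
have e0 : 1 - 2 * 0 != 0 :> R by rewrite mulr0 subr0 oner_neq0.
under eq_fun do rewrite -(mulrA 2).
apply: cvgM; apply: cvgD.
- exact: cvg_cst.
- apply: cvgM.
    by apply: cvgB; [exact: cvg_cst|apply: cvgM => //; exact: cvg_cst].
  by apply: cvgV => //; apply: cvgD => //; exact: cvgB.
- apply: cvgM; first by do 2?apply: cvgD => //; apply: cvgM => //; exact: cvg_cst.
  apply: cvgV => //; apply: cvgB; first exact: cvg_cst.
  by apply: cvgM => //; exact: cvg_cst.
- exact: cvg_cst.
Qed.

Lemma cvg_scaled_path_lower (R : realType) (Q K : R) (r : R^nat) :
  r @ \oo --> (0 : R) -> (fun n => scaled_path_lower Q K (r n)) @ \oo --> Q.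
Proof.
move=> r0; have r2 : (fun n => r n ^+ 2) @ \oo --> (0 : R).
  by rewrite -(mulr0 0); exact: cvgM.
have r12 : (fun n => 12 * r n ^+ 2) @ \oo --> (12 * 0 : R).
  by apply: cvgM => //; exact: cvg_cst.
rewrite /scaled_path_lower.
rewrite [X in _ --> X](_ : Q = Q - 12 * 0 - 16 * K * 0 * (Q + 12 * 0)); last ring.
apply: cvgB; first by apply: cvgB => //; exact: cvg_cst.
apply: cvgM; first by apply: cvgM => //; exact: cvg_cst.
by apply: cvgD => //; exact: cvg_cst.
Qed.

(** Rounding down costs at most 1, hence at most 1/sqrt n after division. *)
Lemma cvg_truncn_ratio (R : realType) (c : R) : 0 < c ->
  (fun n : nat => (Num.truncn (c * Num.sqrt n%:R))%:R / Num.sqrt n%:R) @ \oo --> c.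
Proof.
move=> c0; apply/cvgrPdist_lt => e e0; near=> n.
have r : (Num.sqrt n%:R)^-1 < e.
  by near: n; apply: (cvgr_lt (0 : R)) => //; exact: cvg_inv_sqrt_nat.
have s0 : 0 < Num.sqrt n%:R :> R by rewrite sqrtr_gt0 ltr0n; near: n; exists 1%N.
have := @truncn_itv R (c * Num.sqrt n%:R) (mulr_ge0 (ltW c0) (ltW s0)).
rewrite -natr1; set u := (Num.truncn _)%:R; set s := Num.sqrt _ in s0 r *.
move=> /andP[ul uu]; have -> : c - u / s = (c * s - u) * s^-1 by field; rewrite gt_eqF.
rewrite ger0_norm; last by rewrite mulr_ge0 ?invr_ge0 ?(ltW s0) // subr_ge0.
apply: le_lt_trans r; rewrite ler_piMl ?invr_ge0 ?(ltW s0) //; lra.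
Unshelve. all: by end_near. Qed.

Lemma Qconst_gt0 (R : realType) : 0 < Qconst R.
Proof. by rewrite mulr_gt0 ?sqrtr_gt0 // ln_gt0 // ltrDl sqrtr_gt0. Qed.

(** The case S = 0 of the lower bound. It needs no prior control of a, so it yields the a priori
    bound on a/sqrt n for minimizers. *)
Lemma sum_Balaban_clique_lower (R : realType) (a b : nat) : (0 < a)%N -> (0 < b)%N ->
  a%:R ^+ 2 / (2 * a + b)%:R <= sum_Balaban R (dumbbell a b).
Proof.
move=> a0 b0; have t0 : 0 <= a%:R ^+ 2 / (2 * a + b)%:R :> R by rewrite divr_ge0 ?sqr_ge0.
have := @sum_Balaban_lower R a b 0 a0 b0; rewrite addr0 => h.
apply: le_trans (h t0 _); last by apply: sumr_ge0 => j _; rewrite invr_ge0 sqrtr_ge0.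
rewrite ler_peMl // lerDl divr_ge0 ?sqr_ge0 // subr_ge0 ler_nat; lia.
Qed.

Lemma minimal_dumbbell_ratio_cvg (R : realType) (c : R) (a b : nat -> nat) :
  0 < c -> c ^+ 4 = Qconst R ->
  (forall n : nat, (3 <= n)%N -> minimal_dumbbell R n (a n) (b n)) ->
  (fun n : nat => (a n)%:R / Num.sqrt n%:R) @ \oo --> c.
Proof.
move=> c0 cQ Hmin; have c2 : 0 < c ^+ 2 by rewrite exprn_gt0.
have Q0 := Qconst_gt0 R.
pose r (n : nat) : R := (Num.sqrt n%:R)^-1.
have r0 : r @ \oo --> (0 : R) := @cvg_inv_sqrt_nat R.
(* The competitor: a clique size of asymptotically optimal order, whose index is at most [U n]. *)
pose A (n : nat) := Num.truncn (c * Num.sqrt n%:R).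
pose U n := scaled_upper (Qconst R) (r n) ((A n)%:R / Num.sqrt n%:R).
pose M := (1 + c ^+ 2) ^+ 2.
have UM : U @ \oo --> M.
  have -> : M = (1 + 1 / c ^+ 2) * (c ^+ 2 + Qconst R).
    by rewrite -cQ /M; field; rewrite gt_eqF.
  by apply: cvg_scaled_upper => //; exact: cvg_truncn_ratio.
(* Eventually [U n <= K], so K bounds x^2 for a minimizer, and also x because K >= 1. *)
pose K := M + 1.
have K1 : 1 <= K by rewrite lerDr sqr_ge0.
pose S n := scaled_path_lower (Qconst R) K (r n).
have SQ : S @ \oo --> Qconst R by exact: cvg_scaled_path_lower.
pose e n := 1 - 2 * r n ^+ 2.
have e1 : e @ \oo --> (1 : R).
  rewrite [X in _ --> X](_ : 1 = 1 - 2 * (0 * 0)); last by ring.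
  by apply: cvgB; [exact: cvg_cst|apply: cvgM; [exact: cvg_cst|exact: cvgM]].
(* The right-hand side of [near_minimum]; it vanishes in the limit because M = 1 + Q + 2c^2 and c^4
   = Q. *)
pose E n := `|U n - e n - S n - 2 * c ^+ 2| * K + `|c ^+ 4 - e n * S n|.
have E0 : E @ \oo --> (0 : R).
  rewrite [X in _ --> X](_ : 0 =
    `|M - 1 - Qconst R - 2 * c ^+ 2| * K + `|c ^+ 4 - 1 * Qconst R|); last first.
    rewrite mul1r cQ subrr normr0 addr0 -cQ (_ : _ - _ = 0) ?normr0 ?mul0r //.
    by rewrite /M; ring.
  apply: cvgD.
    apply: cvgM; last exact: cvg_cst.
    apply: cvg_norm; apply: cvgB; last exact: cvg_cst.
    by apply: cvgB => //; exact: cvgB.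
  by apply: cvg_norm; apply: cvgB; [exact: cvg_cst|exact: cvgM].
apply/cvgrPdist_lt => d d0; near=> n.
have n3 : (3 <= n)%N by near: n; exists 3%N.
have UK : U n <= K by near: n; apply: (cvgr_le M) => //; rewrite ltrDl.
have Sn0 : 0 <= S n by near: n; apply: (cvgr_ge (Qconst R)).
have rK : r n <= (4 * K)^-1.
  by near: n; apply: (cvgr_le (0 : R)) => //; rewrite invr_gt0; lra.
(* This bound gives 2A < n and the next gives A >= 1, so the competitor is a genuine dumbbell. *)
have rc : r n < (2 * c)^-1.
  by near: n; apply: (cvgr_lt (0 : R)) => //; rewrite invr_gt0; lra.
have rc' : r n <= c by near: n; apply: (cvgr_le (0 : R)).
have Ed : E n < (d * c) ^+ 2.
  by near: n; apply: (cvgr_lt (0 : R)) => //; rewrite exprn_gt0 // mulr_gt0.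
have n0 : 0 < n%:R :> R by rewrite ltr0n (leq_trans _ n3).
have s0 : 0 < Num.sqrt n%:R :> R by rewrite sqrtr_gt0.
have sE := sqr_sqrtr (ltW n0).
have rs : r n * Num.sqrt n%:R = 1 by rewrite mulVf // gt_eqF.
have [a0 b0 nE amin] := Hmin n n3.
have A0 : (0 < A n)%N.
  by rewrite truncn_gt0 -[X in X <= _]rs ler_wpM2r // ltW.
have An : (2 * A n < n)%N.
  rewrite -(ltr_nat R) natrM; apply: (@le_lt_trans _ _ (2 * (c * Num.sqrt n%:R))).
    by rewrite ler_wpM2l // truncn_le // mulr_ge0 // ltW.
  move: rc; rewrite /r ltf_pV2 ?posrE ?mulr_gt0 // => rc.
  by rewrite -[X in _ < X]sE mulrA expr2 ltr_pM2r.
have opt : sum_Balaban R (dumbbell (a n) (b n)) <= U n.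
  have B0 : (0 < n - 2 * A n)%N by rewrite subn_gt0.
  have BE : (2 * A n + (n - 2 * A n) = n)%N by rewrite subnKC // ltnW.
  exact: le_trans (amin _ _ A0 B0 BE) (sum_Balaban_scaled_upper R A0 B0 BE).
set x := (a n)%:R / _; have x0 : 0 < x by rewrite divr_gt0 // ltr0n.
have xK2 : x ^+ 2 <= K.
  apply: le_trans UK; apply: le_trans opt.
  by rewrite /x expr_div_n sE -[X in _ / X%:R]nE; exact: sum_Balaban_clique_lower.
have xK : x <= K by nra.
have low := sum_Balaban_scaled_lower a0 b0 nE xK.
have {}low := le_trans (low _ Sn0) opt.
have {}low : (1 + e n / x ^+ 2) * (x ^+ 2 + S n) <= U n.
  apply: low; move: rK; rewrite -[X in _ <= X]mul1r ler_pdivlMr; last by lra.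
  by rewrite mulrC.
have := near_minimum c (exprn_gt0 2 x0) xK2 low.
move=> /le_lt_trans /(_ Ed) h.
(* Since x > 0, the factor x + c of x^2 - c^2 is at least c. *)
have {}h : ((x - c) * c) ^+ 2 < (d * c) ^+ 2.
  apply: le_lt_trans h; rewrite subr_sqr !exprMn ler_wpM2l ?sqr_ge0 //.
  by rewrite ler_sqr ?nnegrE ?lerDr ?addr_ge0 // ltW.
rewrite distrC -ltr_sqr ?nnegrE ?normr_ge0 ?(ltW d0) // real_normK ?num_real //.
by move: h; rewrite !exprMn ltr_pM2r.
Unshelve. all: by end_near. Qed.

Unset Implicit Arguments.

(** Positive a and b force n >= 3, so minimality is assumed exactly where balanced dumbbells exist.
    The second claim follows from the first order of a, as n - b = 2a. *)
Theorem theorem7 (R : realType) (a b : nat -> nat)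
  (Hmin : forall n : nat, (3 <= n)%N -> minimal_dumbbell R n (a n) (b n)) :
  let Q : R := Num.sqrt 2 * ln (1 + Num.sqrt 2) in
  ((fun n : nat => (a n)%:R : R^o) =
     (fun n : nat => Q `^ 4^-1 * Num.sqrt n%:R : R^o)
       +o_\oo (fun n : nat => Num.sqrt n%:R : R^o)) /\
  ((fun n : nat => (b n)%:R : R^o) =
     (fun n : nat => n%:R : R^o) +o_\oo (fun n : nat => n%:R : R^o)).
Proof.
move=> Q; have Q0 : 0 < Q by exact: Qconst_gt0.
set c := Q `^ 4^-1; have c0 : 0 < c by rewrite powR_gt0.
have c4 : c ^+ 4 = Q by rewrite -powR_mulrn ?ltW // -powRrM mulVf ?powRr1 ?ltW // pnatr_eq0.
have ac := minimal_dumbbell_ratio_cvg c0 c4 Hmin.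
split; apply/eqaddoP => e e0; near=> n => /=.
  have n0 : 0 < n%:R :> R by rewrite ltr0n; near: n; exists 1%N.
  have s0 : 0 < Num.sqrt n%:R :> R by rewrite sqrtr_gt0.
  have h : `|c - (a n)%:R / Num.sqrt n%:R| < e.
    by near: n; move/cvgrPdist_lt: ac; exact.
  rewrite !fctE [X in e * X]ger0_norm ?(ltW s0) // -[X in X - _](divfK (lt0r_neq0 s0)).
  by rewrite -mulrBl normrM distrC [X in _ * X <= _]ger0_norm ?(ltW s0) // ler_wpM2r ?(ltW s0) ?(ltW h).
have n3 : (3 <= n)%N by near: n; exists 3%N.
have n0 : 0 < n%:R :> R by rewrite ltr0n (leq_trans _ n3).
have s0 : 0 < Num.sqrt n%:R :> R by rewrite sqrtr_gt0.
have h : (a n)%:R / Num.sqrt n%:R < c + 1.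
  by near: n; apply: (cvgr_lt c) => //; rewrite ltrDl.
(* Chosen so that 2a < 2(c+1) sqrt n is at most e n. *)
have r : (Num.sqrt n%:R)^-1 < e / (2 * (c + 1)).
  near: n; apply: (cvgr_lt (0 : R)); first exact: cvg_inv_sqrt_nat.
  by rewrite divr_gt0 //; lra.
have [_ _ nE _] := Hmin n n3.
rewrite !fctE (_ : (b n)%:R - n%:R = - (2 * (a n)%:R)); last first.
  by rewrite -[X in _ - X%:R]nE natrD natrM; ring.
rewrite normrN !ger0_norm ?mulr_ge0 ?(ltW n0) //.
move: h r; rewrite ltr_pdivrMr // ltr_pdivlMr; last lra.
rewrite ltr_pdivrMl // -[X in _ <= _ * X](sqr_sqrtr (ltW n0)).
set s := Num.sqrt _ in s0 * => h; rewrite -(ltr_pM2r s0) => r; lra.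
Unshelve. all: by end_near. Qed.
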